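(* Let $V:\mathbb{R}^n\to\mathbb{R}$ be $L$-smooth ($L>0$) and satisfy the Polyak--Łojasiewicz inequality with parameter $\mu>0$, i.e., with $V^*:=\min_xV(x)$, $$\tfrac12\|\nabla V(x)\|^2\ge\mu\,(V(x)-V^* )\qquad\text{for all }x\in\mathbb{R}^n.$$ Let $(x^k)_{k\ge0}$ be the iterates, starting from $x^0\in\mathbb{R}^n$, of any one of the four methods described in the context (Gonzalez, mean value, Itoh--Abe, randomised Itoh--Abe), with time steps $(\tau_k)\subset[\tau_{\min},\tau_{\max}]$, $0<\tau_{\min}\le\tau_{\max}$, and let $\beta:=\sup_k\beta_k$ with $\beta_k$ the corresponding value given in the context. Then for all $k\ge0$ $$V_k-V^*\le\left(1-\frac{2\mu}{\beta}\right)^k\left(V(x^0)-V^*\right),$$ where $V_k:=\mathbb{E}[V(x^k)]$ (so $V_k=V(x^k)$ for the three deterministic methods).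
   Context: $\|\cdot\|$, $\langle\cdot,\cdot\rangle$: Euclidean norm and inner product; $S^{n-1}$: unit sphere. $V$ is $L$-smooth if it is continuously differentiable and $\nabla V$ is $L$-Lipschitz. Discrete gradient methods: $x^{k+1}$ is an exact solution of $x^{k+1}=x^k-\tau_k\overline{\nabla}V(x^k,x^{k+1})$, where $\overline{\nabla}V$ is one of: (1) Gonzalez: $\overline{\nabla}V(x,y)=\nabla V(\frac{x+y}{2})+\frac{V(y)-V(x)-\langle\nabla V(\frac{x+y}{2}),y-x\rangle}{\|x-y\|^2}(y-x)$ for $x\ne y$, and $\overline{\nabla}V(x,x)=\nabla V(x)$; (2) mean value: $\overline{\nabla}V(x,y)=\int_0^1\nabla V((1-s)x+sy)\,ds$; (3) Itoh--Abe: $(\overline{\nabla}V(x,y))_i=\frac{V(y_1,\ldots,y_i,x_{i+1},\ldots,x_n)-V(y_1,\ldots,y_{i-1},x_i,\ldots,x_n)}{y_i-x_i}$, with $0/0$ interpreted as $\partial_iV(y_1,\ldots,y_{i-1},x_i,\ldots,x_n)$. (4) Randomised Itoh--Abe method: directions $d^1,d^2,\ldots\in S^{n-1}$ are drawn independently from a probability distribution $\Xi$ on $S^{n-1}$ with $\zeta:=\min_{e\in S^{n-1}}\mathbb{E}_{d\sim\Xi}[\langle d,e\rangle^2]>0$; the update is $x^{k+1}=x^k-\tau_k\alpha_kd^{k+1}$, where $\alpha_k\ne0$ solves $\alpha_k=-\frac{V(x^k-\tau_k\alpha_kd^{k+1})-V(x^k)}{\tau_k\alpha_k}$, and $x^{k+1}=x^k$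 is considered a solution whenever $\langle\nabla V(x^k),d^{k+1}\rangle=0$. $\mathbb{E}[V(x^k)]$ is the expectation over the joint distribution of $d^1,\ldots,d^k$. Constants: $\overline{L}_i\le L$ is a Lipschitz constant of $\partial_iV:\mathbb{R}^n\to\mathbb{R}$, and $\overline{L}_{\mathrm{sum}}:=\sqrt{\sum_{i=1}^n\overline{L}_i^2}$. For $d\in S^{n-1}$, $L_d\le L$ is a constant with $|\langle\nabla V(x+\alpha d),d\rangle-\langle\nabla V(x),d\rangle|\le L_d|\alpha|$ for all $x\in\mathbb{R}^n$, $\alpha\in\mathbb{R}$; $L_{\max}\le L$ is the supremum of $L_d$ over $d$ in the support of $\Xi$. Values of $\beta_k$: Gonzalez: $2\left(\frac{1}{\tau_k}+\frac{L^2\tau_k}{2}\right)$; mean value: $2\left(\frac{1}{\tau_k}+\frac{L^2\tau_k}{4}\right)$; Itoh--Abe: $2\left(\frac1{\tau_k}+\overline{L}_{\mathrm{sum}}^2\tau_k\right)$; randomised Itoh--Abe: $\frac{\tau_k}{\zeta}\left(\frac1{\tau_k}+\frac{L_{\max}}{2}\right)^2$. *)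

(* Defs.v *)
From HB Require Import structures.
From mathcomp Require Import all_boot all_order all_algebra.
From mathcomp Require Import all_classical all_reals all_analysis.

Set Implicit Arguments.
Unset Strict Implicit.
Unset Printing Implicit Defensive.

Import Order.TTheory GRing.Theory Num.Theory.
Import numFieldNormedType.Exports.

Local Open Scope classical_set_scope.
Local Open Scope ring_scope.

Definition is_minimum {T : Type} {disp : Order.disp_t} {U : porderType disp}
    (A : set T) (f : T -> U) (m : U) : Prop :=
  (exists2 x, A x & f x = m) /\ (forall x, A x -> (m <= f x)%O).

Section Euclidean.
Context {R : realType} {n : nat}.
Implicit Types (x y u : 'rV[R]_n) (V : 'rV[R]_n -> R).

Definition dot x y : R := \sum_(i < n) x 0 i * y 0 i.

(* The library norm `|x| on 'rV[R]_n is the sup norm, not the Euclidean one. *)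
Definition enorm x : R := Num.sqrt (dot x x).

Definition sphere : set 'rV[R]_n := [set u | enorm u = 1].

Definition partial (i : 'I_n) V x : R := 'D_(delta_mx 0 i) V x.

Definition grad V x : 'rV[R]_n := \row_(i < n) partial i V x.

(* The sup norm and the Euclidean norm induce the same topology and the same
   notion of differentiability on 'rV[R]_n. *)
Definition smooth (L : R) V : Prop :=
  [/\ forall x, differentiable V x,
      continuous (grad V) &
      forall x y, enorm (grad V x - grad V y) <= L * enorm (x - y)].

Definition polyak_lojasiewicz (mu Vstar : R) V : Prop :=
  forall x, mu * (V x - Vstar) <= 2^-1 * enorm (grad V x) ^+ 2.

Definition gonzalez V x y : 'rV[R]_n :=
  if x == y then grad V x
  else let m := 2^-1 *: (x + y) in
    grad V m
    + ((V y - V x - dot (grad V m) (y - x)) / enorm (x - y) ^+ 2) *: (y - x).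

Definition mean_value V x y : 'rV[R]_n :=
  \row_(i < n)
    \int[@lebesgue_measure R]_(s in `[0, 1]) grad V ((1 - s) *: x + s *: y) 0 i.

(* (y_1, ..., y_m, x_{m+1}, ..., x_n) *)
Definition splice (m : nat) x y : 'rV[R]_n :=
  \row_(j < n) if (j < m)%N then y 0 j else x 0 j.

(* Coordinates are numbered from 0, so splice i.+1 x y carries y up to and
   including coordinate i. *)
Definition itoh_abe V x y : 'rV[R]_n :=
  \row_(i < n)
    if y 0 i == x 0 i then partial i V (splice i x y)
    else (V (splice i.+1 x y) - V (splice i x y)) / (y 0 i - x 0 i).

Definition discrete_gradient_iterates
    (dgrad : ('rV[R]_n -> R) -> 'rV[R]_n -> 'rV[R]_n -> 'rV[R]_n)
    V (tau : nat -> R) (x : nat -> 'rV[R]_n) : Prop :=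
  forall k, x k.+1 = x k - tau k *: dgrad V (x k) (x k.+1).

(* x' is an admissible successor of x for time step t and direction u. *)
Definition randomised_itoh_abe_step V (t : R) u x x' : Prop :=
  (exists a : R, [/\ a != 0,
      a = - ((V (x - (t * a) *: u) - V x) / (t * a)) &
      x' = x - (t * a) *: u])
  \/ (dot (grad V x) u = 0 /\ x' = x).

End Euclidean.

Arguments sphere : clear implicits.

Definition borel_rV (R : realType) (n : nat) :=
  g_sigma_algebraType (@open 'rV[R]_n).

Section RandomDirections.
Context {R : realType} {n : nat}.

Definition measure_support (Xi : probability (borel_rV R n) R) : set 'rV[R]_n :=
  [set u | forall U : set 'rV[R]_n, open U -> U u -> (0 < Xi U)%E].

Context {disp : measure_display} {Omega : measurableType disp}.
Implicit Type d : nat -> Omega -> borel_rV R n.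

(* Mutual independence: the product rule over every finite subfamily. *)
Definition independent_directions (P : probability Omega R) d : Prop :=
  forall (s : seq nat) (B : nat -> set (borel_rV R n)),
    uniq s -> (forall i, measurable (B i)) ->
    P (\bigcap_(i in [set` s]) (d i @^-1` B i)) =
    (\prod_(i <- s) P (d i @^-1` B i))%E.

Definition iid_directions (P : probability Omega R)
    (Xi : probability (borel_rV R n) R) d : Prop :=
  [/\ forall k, measurable_fun setT (d k),
      forall k (B : set (borel_rV R n)), measurable B ->
        P (d k @^-1` B) = Xi B &
      independent_directions P d].

(* sigma-algebra generated by d 0, ..., d (k - 1) *)
Definition history d (k : nat) : set (set Omega) :=
  <<s \bigcup_(j in `I_k) preimage_set_system setT (d j) measurable >>.

(* The step from x k to x k.+1 uses the direction d k.  As the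
   implicit update may have several solutions, x k is required to be a
   measurable function of the directions drawn so far; this is what gives a
   meaning to the expectation of V (x k) over their joint distribution. *)
Definition randomised_itoh_abe_iterates (V : 'rV[R]_n -> R) (tau : nat -> R) d
    (x0 : 'rV[R]_n) (x : nat -> Omega -> 'rV[R]_n) : Prop :=
  [/\ forall w, x 0%N w = x0,
      forall k (B : set (borel_rV R n)), measurable B ->
        history d k (x k @^-1` B) &
      forall k w,
        randomised_itoh_abe_step V (tau k) (d k w) (x k w) (x k.+1 w)].

End RandomDirections.

Section Rates.
Context {R : realType}.
Implicit Types L t zeta : R.

Definition beta_gonzalez L t : R := 2 * (t^-1 + L ^+ 2 * t / 2).

Definition beta_mean_value L t : R := 2 * (t^-1 + L ^+ 2 * t / 4).

Definition beta_itoh_abe Lsum t : R := 2 * (t^-1 + Lsum ^+ 2 * t).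

Definition beta_randomised zeta Lmax t : R :=
  t / zeta * (t^-1 + Lmax / 2) ^+ 2.

Definition sup_beta (beta : R -> R) (tau : nat -> R) : R :=
  sup (range (fun k => beta (tau k))).

End Rates.

(* Main.v *)
Require Import Defs.
From mathcomp Require Import all_boot all_order all_algebra.
From mathcomp Require Import all_classical all_reals all_analysis.
From mathcomp Require Import measurable_realfun.
From mathcomp Require Import ring lra.
Set Implicit Arguments.
Unset Strict Implicit.
Unset Printing Implicit Defensive.
Import Order.TTheory GRing.Theory Num.Theory.
Import numFieldNormedType.Exports.
Local Open Scope classical_set_scope.
Local Open Scope ring_scope.

(* For each method one step satisfies
   [|grad V(x_k)|^2 <= beta_k (V(x_k) - V(x_{k+1}))], in conditional expectation
   for the randomised one; with the Polyak-Lojasiewicz inequality this makes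
   [V - Vstar] shrink by the factor [1 - 2 mu / beta].
   For a discrete gradient [g], [<g, y - x> = V y - V x] gives
   [V(x_k) - V(x_{k+1}) = tau_k |g|^2], and [|g - grad V(x_k)|^2] is at most
   [C |x_{k+1} - x_k|^2], with [C = L^2/2], [L^2/4] and [Lsum^2] respectively.
   For the randomised method [<grad V(x_k), d_k>^2] is at most
   [zeta beta_k (V(x_k) - V(x_{k+1}))] almost surely, and since [d_k] is
   independent of [x_k], Tonelli's theorem bounds its expectation from below by
   [zeta E|grad V(x_k)|^2]. *)

(** * Euclidean geometry and line integrals of the gradient *)

Section EuclideanTheory.
Context {R : realType} {n : nat}.
Implicit Types (x y z u : 'rV[R]_n) (a : R).

Lemma dotC x y : dot x y = dot y x.
Proof. by apply: eq_bigr => i _; rewrite mulrC. Qed.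

Lemma dotDl x y z : dot (x + y) z = dot x z + dot y z.
Proof. by rewrite -big_split; apply: eq_bigr => i _; rewrite !mxE mulrDl. Qed.

Lemma dotZl a x y : dot (a *: x) y = a * dot x y.
Proof. by rewrite mulr_sumr; apply: eq_bigr => i _; rewrite !mxE mulrA. Qed.

Lemma dotNl x y : dot (- x) y = - dot x y.
Proof. by rewrite -scaleN1r dotZl mulN1r. Qed.

Lemma dotBl x y z : dot (x - y) z = dot x z - dot y z.
Proof. by rewrite dotDl dotNl. Qed.

Lemma dotZr a x y : dot x (a *: y) = a * dot x y.
Proof. by rewrite dotC dotZl dotC. Qed.

Lemma dotDr x y z : dot z (x + y) = dot z x + dot z y.
Proof. by rewrite !(dotC z) dotDl. Qed.

Lemma dotNr x y : dot x (- y) = - dot x y.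
Proof. by rewrite dotC dotNl dotC. Qed.

Lemma dotBr x y z : dot z (x - y) = dot z x - dot z y.
Proof. by rewrite !(dotC z) dotBl. Qed.

Lemma dot_ge0 x : 0 <= dot x x.
Proof. by apply: sumr_ge0 => i _; rewrite -expr2 sqr_ge0. Qed.

Lemma dot_eq0 x : (dot x x == 0) = (x == 0).
Proof.
apply/eqP/eqP => [x0|->]; last by apply: big1 => i _; rewrite mxE mul0r.
apply/rowP => i; rewrite mxE; apply/eqP; rewrite -sqrf_eq0 expr2; apply/eqP.
by apply: (psumr_eq0P _ x0) => // j _; rewrite -expr2 sqr_ge0.
Qed.

Lemma enorm_sqr x : enorm x ^+ 2 = dot x x.
Proof. by rewrite sqr_sqrtr // dot_ge0. Qed.

Lemma enorm_ge0 x : 0 <= enorm x.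
Proof. exact: sqrtr_ge0. Qed.

Lemma enormZ a x : enorm (a *: x) = `|a| * enorm x.
Proof.
by rewrite /enorm dotZl dotZr mulrA -expr2 sqrtrM ?sqr_ge0// sqrtr_sqr.
Qed.

Lemma enormN x : enorm (- x) = enorm x.
Proof. by rewrite -scaleN1r enormZ normrN1 mul1r. Qed.

Lemma enormB x y : enorm (x - y) = enorm (y - x).
Proof. by rewrite -opprB enormN. Qed.

(** Cauchy-Schwarz: the squared length of [dot y y *: x - dot x y *: y] is [dot y y] times the
    difference of the two sides. *)
Lemma dot_sqr_le x y : dot x y ^+ 2 <= dot x x * dot y y.
Proof.
have [->|y0] := eqVneq y 0.
  by rewrite -(scale0r (0 : 'rV_n)) !dotZr !mul0r mulr0 expr0n.
have yy : 0 < dot y y by rewrite lt_def dot_eq0 y0 dot_ge0.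
have := dot_ge0 (dot y y *: x - dot x y *: y).
rewrite !(dotBl, dotBr, dotZl, dotZr) (dotC y x) => H.
rewrite -subr_ge0 -(pmulr_rge0 _ yy).
by apply: le_trans H _; rewrite le_eqVlt; apply/orP; left; apply/eqP; ring.
Qed.

Lemma normr_dot_le x y : `|dot x y| <= enorm x * enorm y.
Proof.
rewrite -ler_sqr ?nnegrE ?mulr_ge0 ?enorm_ge0//.
by rewrite real_normK ?num_real// exprMn !enorm_sqr dot_sqr_le.
Qed.

(* Testing against [x] itself bounds a vector through its inner products. *)
Lemma enorm_le_dot x a : 0 <= a -> (forall u, dot x u <= a * enorm u) ->
  enorm x <= a.
Proof.
move=> a0 /(_ x); rewrite -enorm_sqr expr2.
have [->//|x0] := eqVneq (enorm x) 0.
by rewrite ler_pM2r// lt_def x0 enorm_ge0.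
Qed.

Lemma dot_deltar x i : dot x (delta_mx 0 i) = x 0 i.
Proof.
rewrite /dot (bigD1 i)//= mxE !eqxx mulr1 big1 ?addr0// => j ji.
by rewrite mxE (negbTE ji) andbF mulr0.
Qed.

End EuclideanTheory.

Section Smooth.
Context {R : realType} {n : nat}.
Implicit Types (x y u : 'rV[R]_n) (V : 'rV[R]_n -> R).

(** The differential is linear, so expanding [u] in the standard basis leaves only partial
    derivatives. *)
Lemma dot_grad V x u : differentiable V x -> dot (grad V x) u = 'D_u V x.
Proof.
move=> dV; rewrite deriveE// {2}(row_sum_delta u) linear_sum.
by apply: eq_bigr => i _; rewrite linearZ mxE /partial deriveE// mulrC.
Qed.

Lemma is_derive_line V x u (s : R) : (forall y, differentiable V y) ->
  is_derive s 1 (fun t => V (x + t *: u)) (dot (grad V (x + s *: u)) u).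
Proof.
move=> dV; rewrite dot_grad//.
(* The difference quotient at [s] is that of [V] at [x + s *: u] in direction [u]. *)
have E : (fun h => h^-1 *: (V (x + (h *: 1 + s) *: u) - V (x + s *: u))) =
         (fun h => h^-1 *: (V (h *: u + (x + s *: u)) - V (x + s *: u))).
  apply/funext => h; congr (_ *: (V _ - _)).
  by rewrite [h%:A]mulr1 scalerDl addrCA.
by apply: DeriveDef; rewrite /derivable /derive /= E//; exact: diff_derivable.
Qed.

Lemma line_MVT V x u : (forall y, differentiable V y) ->
  exists2 s : R, 0 <= s <= 1 &
    V (x + u) - V x = dot (grad V (x + s *: u)) u.
Proof.
move=> dV; have dl s := is_derive_line x u s dV.
have [] := MVT_segment ler01 (fun s _ => dl s).
  by apply: derivable_within_continuous => s _; exact: ex_derive.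
move=> s; rewrite in_itv/= => s01; rewrite scale1r scale0r addr0 subr0 mulr1.
by move=> E; exists s.
Qed.

Lemma continuous_dot {T : topologicalType} (f g : T -> 'rV[R]_n) :
  continuous f -> continuous g -> continuous (fun t => dot (f t) (g t)).
Proof.
move=> cf cg t; rewrite /dot; apply: cvg_big => [|i _].
  exact: add_continuous.
have coord h : continuous h -> {for t, continuous (fun t' => (h t' : 'rV[R]_n) 0 i)}.
  move=> ch; apply: (@continuous_comp _ _ _ h (fun x : 'rV[R]_n => x 0 i)).
    exact: ch.
  exact: coord_continuous.
by apply: cvgM; exact: coord.
Qed.

Lemma continuous_dot_grad V x u e : continuous (grad V) ->
  continuous (fun s : R => dot (grad V (x + s *: u)) e).
Proof.
move=> cV; apply: continuous_dot; last exact: cst_continuous.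
move=> s; apply: (@continuous_comp _ _ _ (fun t : R => x + t *: u)); last exact: cV.
apply: cvgD; first exact: cvg_cst.
by apply: cvgZr_tmp; exact: cvg_id.
Qed.

(** Unlike [line_MVT], the integral form yields the factor 1/2 in first-order remainders, on which
    the Gonzalez and randomised constants depend. *)
Lemma line_FTC V x u : (forall y, differentiable V y) -> continuous (grad V) ->
  V (x + u) - V x =
  \int[@lebesgue_measure R]_(s in `[0, 1]) dot (grad V (x + s *: u)) u.
Proof.
move=> dV cV; have dl s := is_derive_line x u s dV.
rewrite /Rintegral (@continuous_FTC2 R _ (fun t => V (x + t *: u))) ?ltr01//=.
- by rewrite scale1r scale0r addr0.
- exact/continuous_subspaceT/continuous_dot_grad.
- have cl : continuous (fun t : R => V (x + t *: u)).
    by move=> s; apply/differentiable_continuous/derivable1_diffP.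
  split=> //; first exact/cvg_at_right_filter/cl.
  exact/cvg_at_left_filter/cl.
- by move=> s _; rewrite derive1E derive_val.
Qed.

End Smooth.

Lemma continuous_integrable01 {R : realType} (g : R -> R) : continuous g ->
  (@lebesgue_measure R).-integrable `[0, 1] (EFin \o g).
Proof.
move=> cg; apply: continuous_compact_integrable; first exact: segment_compact.
exact: continuous_subspaceT.
Qed.

(** The interval has length 1, so [c] is its own average, and the deviation is at most the integral
    of [K * s], which is [K / 2]. *)
Lemma Rintegral01_dist_le {R : realType} (g : R -> R) (c K : R) :
  continuous g -> (forall s, 0 <= s <= 1 -> `|g s - c| <= K * s) ->
  `|\int[@lebesgue_measure R]_(s in `[0, 1]) g s - c| <= K / 2.
Proof.
move=> cg gle.
have m01 : measurable (`[0, 1] : set R) by [].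
have cK : continuous (fun s : R => K * s).
  by move=> s; apply: cvgM; [exact: cvg_cst|exact: cvg_id].
have -> : c = \int[@lebesgue_measure R]_(s in `[0, 1]) cst c s.
  rewrite Rintegral_cst//.
  have -> : fine (@lebesgue_measure R `[0, 1]) = 1.
    by have /= -> := lebesgue_measure_itv (R := R) `[0, 1]; rewrite lte01 oppr0 adde0.
  by rewrite mulr1.
have icst := continuous_integrable01 (@cst_continuous R R c).
rewrite -RintegralB//; last exact: continuous_integrable01.
have cgc : continuous (fun s : R => g s - c).
  by move=> s; apply: cvgB; [exact: cg|exact: cvg_cst].
apply: le_trans (le_normr_Rintegral _ (continuous_integrable01 cgc)) _ => //.
apply: (@le_trans _ _ (\int[@lebesgue_measure R]_(s in `[0, 1]) (K * s))).
  apply: le_Rintegral => //.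
  - by apply: continuous_integrable01 => s; apply: cvg_norm; exact: cgc.
  - exact: continuous_integrable01.
rewrite /Rintegral (@continuous_FTC2 R _ (fun t => K / 2 * t ^+ 2)) ?ltr01//=.
- lra.
- exact/continuous_subspaceT.
- have cl : continuous (fun t : R => K / 2 * t ^+ 2).
    by move=> s; apply/differentiable_continuous/derivable1_diffP.
  split=> //; first exact/cvg_at_right_filter/cl.
  exact/cvg_at_left_filter/cl.
- move=> s _; rewrite derive1E.
  have dg : is_derive s 1 (fun t => K / 2 * t ^+ 2) (K * s).
    by apply: is_derive_eq; rewrite /GRing.scale/=; field.
  by rewrite derive_val.
Qed.

(** * Discrete gradients *)

Lemma sqr_le_of_normr_le {R : realDomainType} (a b : R) :
  `|a| <= b -> a ^+ 2 <= b ^+ 2.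
Proof.
by move=> ab; rewrite -real_normK ?num_real// ler_sqr// nnegrE (le_trans _ ab).
Qed.

(* The right summand is chosen so that the result has inner product [r] with [w]. *)
Lemma enorm_sqr_shift {R : realType} {n : nat} (p w : 'rV[R]_n) (r : R) :
  dot w w != 0 ->
  enorm (p + ((r - dot p w) / dot w w) *: w) ^+ 2 =
  enorm p ^+ 2 + r ^+ 2 / dot w w - dot p w ^+ 2 / dot w w.
Proof.
move=> w0; rewrite !enorm_sqr dotDl !dotDr !dotZl !dotZr (dotC w p).
by field.
Qed.

Lemma Rintegral01_sum {R : realType} (I : Type) (r : seq I) (h : I -> R -> R) :
  (forall i, continuous (h i)) ->
  \int[@lebesgue_measure R]_(s in `[0, 1]) (\sum_(i <- r) h i s) =
  \sum_(i <- r) \int[@lebesgue_measure R]_(s in `[0, 1]) h i s.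
Proof.
move=> ch; elim: r => [|i r IH].
  rewrite big_nil; under eq_Rintegral do rewrite big_nil.
  by rewrite Rintegral_cst// mul0r.
rewrite big_cons -IH -RintegralD//; try exact: continuous_integrable01.
  by apply: eq_Rintegral => s _; rewrite big_cons.
apply: continuous_integrable01 => s; apply: cvg_big => [|j _].
  exact: add_continuous.
exact: ch.
Qed.

Section DiscreteGradients.
Context {R : realType} {n : nat} (V : 'rV[R]_n -> R) (L : R).
Hypothesis V_smooth : smooth L V.
Implicit Types x y u e : 'rV[R]_n.

Let dV : forall x, differentiable V x. Proof. by case: V_smooth. Qed.
Let cV : continuous (grad V). Proof. by case: V_smooth. Qed.
Let lipV x y : enorm (grad V x - grad V y) <= L * enorm (x - y).
Proof. by case: V_smooth. Qed.

(** The bound is assumed only along [u], so that both the global constant [L] and a directional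
    constant can supply [K]. *)
Lemma first_order_remainder x u (K : R) :
  (forall s, 0 <= s <= 1 ->
    `|dot (grad V (x + s *: u)) u - dot (grad V x) u| <= K * s) ->
  `|V (x + u) - V x - dot (grad V x) u| <= K / 2.
Proof.
move=> gK; rewrite (line_FTC _ _ dV cV).
exact/Rintegral01_dist_le/gK/continuous_dot_grad.
Qed.

Lemma grad_line_dist x u e (s : R) : 0 <= s ->
  `|dot (grad V (x + s *: u)) e - dot (grad V x) e| <=
    L * enorm u * enorm e * s.
Proof.
move=> s0; rewrite -dotBl; apply: le_trans (normr_dot_le _ _) _.
rewrite [leRHS]mulrAC ler_wpM2r ?enorm_ge0//.
by apply: le_trans (lipV _ _) _; rewrite addrC addKr enormZ ger0_norm// mulrA mulrAC.
Qed.

Lemma gonzalez_secant x y : dot (gonzalez V x y) (y - x) = V y - V x.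
Proof.
rewrite /gonzalez; have [->|xy] := eqVneq x y.
  by rewrite !subrr -(scale0r (0 : 'rV_n)) dotZr mul0r.
rewrite dotDl dotZl enormB enorm_sqr divfK; first by ring.
by rewrite dot_eq0 subr_eq0 eq_sym.
Qed.

(* Along [y - x] the discrete gradient is an average of [grad V] over the
   segment, orthogonally to it it is [grad V] at the midpoint. *)
Lemma gonzalez_dist x y :
  enorm (gonzalez V x y - grad V x) ^+ 2 <= L ^+ 2 / 2 * enorm (y - x) ^+ 2.
Proof.
have [<-|xy] := eqVneq x y.
  by rewrite /gonzalez eqxx !subrr !enorm_sqr -(scale0r (0 : 'rV_n)) !dotZr !mul0r mulr0.
set w := y - x; set m := 2^-1 *: (x + y).
have mE : m - x = 2^-1 *: w by apply/rowP => i; rewrite !mxE; field.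
have ww : dot w w != 0 by rewrite dot_eq0 subr_eq0 eq_sym.
set p := grad V m - grad V x.
set r := V y - V x - dot (grad V x) w.
(* Subtracting [grad V x] from the midpoint gradient leaves [p]; the secant defect becomes
   [r - dot p w], as in [enorm_sqr_shift]. *)
have -> : gonzalez V x y - grad V x = p + ((r - dot p w) / dot w w) *: w.
  rewrite /gonzalez (negbTE xy) -/m -/w enormB -/w enorm_sqr addrAC.
  congr (_ + (_ / _) *: _); rewrite dotBl /r; ring.
(* The midpoint is at distance [enorm w / 2] from [x]. *)
have pp : enorm p ^+ 2 <= L ^+ 2 / 4 * dot w w.
  rewrite -enorm_sqr (_ : _ / 4 * _ = (L * (2^-1 * enorm w)) ^+ 2); last by field.
  apply: sqr_le_of_normr_le; rewrite ger0_norm ?enorm_ge0//.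
  by have := lipV m x; rewrite mE enormZ (@ger0_norm _ 2^-1).
(* Here [r] is the first-order remainder at [x], of size at most [L * dot w w / 2]. *)
have rr : r ^+ 2 <= L ^+ 2 / 4 * dot w w ^+ 2.
  rewrite (_ : _ / 4 * _ = (L * dot w w / 2) ^+ 2); last by field.
  apply: sqr_le_of_normr_le.
  rewrite /r -{1}(subrK x y) -/w (addrC w); apply: first_order_remainder.
  move=> s /andP[s0 _]; apply: le_trans (grad_line_dist _ _ _ s0) _.
  by rewrite -enorm_sqr expr2 mulrA.
have w0 : 0 < dot w w by rewrite lt_def ww dot_ge0.
rewrite enorm_sqr_shift// enorm_sqr; rewrite enorm_sqr in pp.
have {}rr : r ^+ 2 / dot w w <= L ^+ 2 / 4 * dot w w.
  by rewrite ler_pdivrMr// (le_trans rr)// expr2 mulrA.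
(* The subtracted term may be dropped; the other two contribute [L ^+ 2 / 4] each. *)
have : 0 <= dot p w ^+ 2 / dot w w by rewrite divr_ge0 ?sqr_ge0// ltW.
rewrite enorm_sqr; lra.
Qed.

Lemma dot_mean_value x y e : dot (mean_value V x y) e =
  \int[@lebesgue_measure R]_(s in `[0, 1]) dot (grad V (x + s *: (y - x))) e.
Proof.
have ch i : continuous (fun s : R => grad V (x + s *: (y - x)) 0 i).
  move=> s; have := @continuous_dot_grad _ _ V x (y - x) (delta_mx 0 i) cV.
  move=> /(_ s); rewrite /continuous_at dot_deltar.
  by under eq_fun do rewrite dot_deltar.
have segE s : (1 - s) *: x + s *: y = x + s *: (y - x).
  by apply/rowP => j; rewrite !mxE; ring.
have chm i : continuous (fun s : R => grad V (x + s *: (y - x)) 0 i * e 0 i).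
  by move=> s; apply: cvgM; [exact: ch|exact: cvg_cst].
rewrite [RHS]Rintegral01_sum//; apply: eq_bigr => i _.
have -> : mean_value V x y 0 i =
    \int[@lebesgue_measure R]_(s in `[0, 1]) grad V (x + s *: (y - x)) 0 i.
  rewrite /mean_value mxE.
  by apply: eq_Rintegral => s _; rewrite segE.
by symmetry; apply: RintegralZr => //; exact: continuous_integrable01.
Qed.

Lemma mean_value_secant x y : dot (mean_value V x y) (y - x) = V y - V x.
Proof. by rewrite dot_mean_value -line_FTC// [x + _]addrC subrK. Qed.

(** Tested against [e], the discrete gradient is an average over the segment, where the deviation
    from [grad V x] grows linearly in [s]; averaging halves the Lipschitz bound. *)
Lemma mean_value_dist x y :
  enorm (mean_value V x y - grad V x) ^+ 2 <= L ^+ 2 / 4 * enorm (y - x) ^+ 2.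
Proof.
have lip_ge0 : 0 <= L * enorm (y - x) by exact: le_trans (enorm_ge0 _) (lipV _ _).
have -> : L ^+ 2 / 4 * enorm (y - x) ^+ 2 = (L * enorm (y - x) / 2) ^+ 2 by field.
apply: sqr_le_of_normr_le; rewrite ger0_norm ?enorm_ge0//.
apply: enorm_le_dot => [|e]; first by rewrite divr_ge0.
rewrite dotBl dot_mean_value; apply: le_trans (ler_norm _) _.
rewrite mulrAC; apply: Rintegral01_dist_le; first exact: continuous_dot_grad.
by move=> s /andP[s0 _]; exact: grad_line_dist.
Qed.

(** The splices form a path from [x] to [y] that moves along one coordinate axis at a time. *)
Lemma spliceS (i : 'I_n) x y :
  splice i.+1 x y = splice i x y + (y 0 i - x 0 i) *: delta_mx 0 i.
Proof.
apply/rowP => j; rewrite !mxE ltnS leq_eqVlt eqxx/=.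
have [->|] := eqVneq j i; first by rewrite ltnn eqxx/= mulr1 addrC subrK.
move=> ji; have -> : (j == i :> nat) = false by exact: negbTE.
by rewrite mulr0 addr0.
Qed.

(** The coordinate terms telescope along the splices; where [x] and [y] agree, consecutive splices
    coincide and the term vanishes. *)
Lemma itoh_abe_secant x y : dot (itoh_abe V x y) (y - x) = V y - V x.
Proof.
transitivity (\sum_(i < n) (V (splice i.+1 x y) - V (splice i x y))).
  apply: eq_bigr => i _; rewrite !mxE; case: eqVneq => [yx|yx].
    by rewrite spliceS yx subrr scale0r addr0 subrr mulr0.
  by rewrite divfK// subr_eq0.
rewrite -(big_mkord xpredT (fun i => V (splice i.+1 x y) - V (splice i x y))).
rewrite telescope_sumr//; congr (V _ - V _); apply/rowP => j; rewrite mxE//.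
by rewrite ltn_ord.
Qed.

Lemma ler_enorm u e : (forall i, `|u 0 i| <= `|e 0 i|) -> enorm u <= enorm e.
Proof.
move=> ue; rewrite /enorm ler_wsqrtr//; apply: ler_sum => i _.
by rewrite -!expr2 -(real_normK (num_real (e 0 i))); exact: sqr_le_of_normr_le.
Qed.

(** The mean value theorem on the axis segment between two splices turns the quotient into a partial
    derivative at a point [z]. Each coordinate of [z] lies between those of [x] and [y], so [z] is
    no farther from [x] than [y] is. *)
Lemma itoh_abe_coord i x y : exists2 z : 'rV[R]_n,
  enorm (z - x) <= enorm (y - x) & itoh_abe V x y 0 i = partial i V z.
Proof.
rewrite mxE; case: eqVneq => [yx|yx].
  exists (splice i x y) => //; apply: ler_enorm => j; rewrite !mxE.
  by case: ifP => // _; rewrite subrr normr0.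
have [s s01] := line_MVT (splice i x y) ((y 0 i - x 0 i) *: delta_mx 0 i) dV.
rewrite -spliceS => ->; rewrite dotZr mulrC mulKf ?subr_eq0// dot_deltar mxE.
eexists; last reflexivity.
apply: ler_enorm => j; rewrite !mxE eqxx/=.
have [->|ji] := eqVneq j i.
  rewrite ltnn mulr1 addrC addKr normrM ler_piMl//.
  by case/andP: s01 => s0 s1; rewrite ger0_norm.
by rewrite !mulr0 addr0; case: ifP => // _; rewrite subrr normr0.
Qed.

Lemma itoh_abe_dist (Lbar : 'I_n -> R) x y :
  (forall i y z, `|partial i V y - partial i V z| <= Lbar i * enorm (y - z)) ->
  enorm (itoh_abe V x y - grad V x) ^+ 2 <=
  (\sum_(i < n) Lbar i ^+ 2) * enorm (y - x) ^+ 2.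
Proof.
move=> Lip; rewrite enorm_sqr mulr_suml; apply: ler_sum => i _.
rewrite -expr2 -exprMn; apply: sqr_le_of_normr_le.
have [z zx E] := itoh_abe_coord i x y.
rewrite mxE E !mxE; apply: le_trans (Lip i z x) _.
(* Nonnegativity follows from the Lipschitz bound between a unit vector and the origin. *)
have Lbar0 : 0 <= Lbar i.
  have := Lip i (delta_mx 0 i) 0.
  rewrite subr0 /enorm dot_deltar mxE !eqxx sqrtr1 mulr1.
  exact: le_trans.
exact: ler_wpM2l.
Qed.

End DiscreteGradients.

(** * Deterministic rates *)

(* The ratio [q] may be negative, but only when [e] vanishes identically. *)
Lemma geometric_decay {R : realDomainType} (q : R) (e : nat -> R) :
  (forall k, 0 <= e k) -> (forall k, e k.+1 <= q * e k) ->
  forall k, e k <= q ^+ k * e 0%N.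
Proof.
move=> e0 eS; have [q0|q0] := leP 0 q.
  elim=> [|k IH]; first by rewrite expr0 mul1r.
  by apply: le_trans (eS k) _; rewrite exprS -mulrA ler_wpM2l.
have e_eq0 k : e k = 0.
  apply/eqP; rewrite eq_le e0 andbT -(nmulr_rge0 _ q0).
  exact: le_trans (e0 k.+1) (eS k).
by move=> k; rewrite !e_eq0 mulr0.
Qed.

(** The hypothesis first forces [e - e'] to be nonnegative; only then may [b] be raised to
    [beta]. *)
Lemma PL_contraction {R : realFieldType} (mu b beta e e' : R) :
  0 < mu -> 0 < b -> b <= beta -> 0 <= e ->
  2 * mu * e <= b * (e - e') -> e' <= (1 - 2 * mu / beta) * e.
Proof.
move=> mu0 b0 bbeta e0 H.
have beta0 := lt_le_trans b0 bbeta.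
have d0 : 0 <= e - e' by rewrite -(pmulr_rge0 _ b0) (le_trans _ H)// !mulr_ge0// ltW.
have : 2 * mu * e / beta <= e - e'.
  by rewrite ler_pdivrMr// (le_trans H)// mulrC ler_wpM2l.
rewrite mulrBl mul1r (_ : 2 * mu / beta * e = 2 * mu * e / beta); last by field; lra.
lra.
Qed.

(** The bound [M] makes [sup] a genuine supremum; on an unbounded set it would be the default value
    0. *)
Lemma sup_beta_ge {R : realType} (beta : R -> R) (tau : nat -> R) (M : R) k :
  (forall j, beta (tau j) <= M) -> beta (tau k) <= sup_beta beta tau.
Proof.
move=> betaM; apply: ub_le_sup; last by exists k.
by exists M => _ [j _ <-].
Qed.

Section DeterministicRates.
Context {R : realType} {n : nat} (V : 'rV[R]_n -> R) (mu Vstar taumin taumax : R).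
Variable tau : nat -> R.
Hypotheses (Vstar_min : is_minimum setT V Vstar) (mu_gt0 : 0 < mu).
Hypotheses (V_PL : polyak_lojasiewicz mu Vstar V) (taumin_gt0 : 0 < taumin).
Hypothesis tau_bounds : forall k, taumin <= tau k <= taumax.

(** With [g] the discrete gradient of the step, the squared gradient norm is at most
    [(2 + 2 * C * tau k ^+ 2) * enorm g ^+ 2], which is [beta (tau k)] times the decrease
    [tau k * enorm g ^+ 2]. *)
Lemma discrete_gradient_rate
    (dgrad : ('rV[R]_n -> R) -> 'rV[R]_n -> 'rV[R]_n -> 'rV[R]_n) (C : R)
    (beta : R -> R) (x : nat -> 'rV[R]_n) :
  0 <= C -> (forall t, beta t = 2 * (t^-1 + C * t)) ->
  (forall x y, dot (dgrad V x y) (y - x) = V y - V x) ->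
  (forall x y,
    enorm (dgrad V x y - grad V x) ^+ 2 <= C * enorm (y - x) ^+ 2) ->
  discrete_gradient_iterates dgrad V tau x ->
  forall k, V (x k) - Vstar <=
    (1 - 2 * mu / sup_beta beta tau) ^+ k * (V (x 0%N) - Vstar).
Proof.
move=> C0 betaE secant dist iter.
have taumin_le k : taumin <= tau k by case/andP: (tau_bounds k).
have le_taumax k : tau k <= taumax by case/andP: (tau_bounds k).
have tau_gt0 k : 0 < tau k by exact: lt_le_trans (taumin_le k).
have V_ge k : 0 <= V (x k) - Vstar by rewrite subr_ge0; case: Vstar_min => _; apply.
apply: (geometric_decay (e := fun k => V (x k) - Vstar)) => // k.
have beta_gt0 : 0 < beta (tau k).
  by rewrite betaE mulr_gt0// ltr_wpDr ?mulr_ge0 ?invr_gt0// ltW.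
apply: (PL_contraction mu_gt0 beta_gt0) => //.
  apply: (@sup_beta_ge _ _ _ (2 * (taumin^-1 + C * taumax))) => j.
  by rewrite betaE ler_pM2l// lerD ?lef_pV2 ?posrE ?ler_wpM2l.
set g := dgrad V (x k) (x k.+1).
have xE : x k.+1 - x k = - (tau k *: g) by rewrite iter addrC addKr.
have dE : V (x k) - V (x k.+1) = tau k * enorm g ^+ 2.
  by rewrite -opprB -secant xE dotNr dotZr opprK enorm_sqr.
have := dist (x k) (x k.+1); rewrite -/g xE enormN enormZ exprMn.
rewrite real_normK ?num_real// => {}dist.
have gle : enorm (grad V (x k)) ^+ 2 <=
    2 * enorm g ^+ 2 + 2 * enorm (g - grad V (x k)) ^+ 2.
  (* The right side minus the left is exactly the squared norm of [2 *: g - grad V (x k)]. *)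
  have := dot_ge0 (2 *: g - grad V (x k)).
  rewrite !enorm_sqr !(dotBl, dotBr, dotZl, dotZr) (dotC _ g); lra.
have := V_PL (x k); rewrite opprB addrA subrK dE betaE => PL.
rewrite -subr_ge0; rewrite -subr_ge0 in PL.
have -> : 2 * ((tau k)^-1 + C * tau k) * (tau k * enorm g ^+ 2) =
  2 * enorm g ^+ 2 + 2 * (C * (tau k ^+ 2 * enorm g ^+ 2)).
  by field; rewrite gt_eqF.
lra.
Qed.

End DeterministicRates.

(** * Borel sets and the support of the direction law *)

Section Borel.
Context {R : realType} {n : nat}.

Lemma open_borel_measurable (U : set 'rV[R]_n) :
  open U -> measurable (U : set (borel_rV R n)).
Proof. by move=> oU; exact: sub_sigma_algebra. Qed.

Lemma continuous_borel_measurable (f : 'rV[R]_n -> R) : continuous f ->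
  measurable_fun [set: borel_rV R n] (f : borel_rV R n -> R).
Proof.
move=> cf; apply: (@measurability _ _ _ (measurableTypeR R) _ _ _ (RGenOInfty.measurableE R)).
move=> _ [_ [a ->] <-]; rewrite setTI; apply: open_borel_measurable.
by apply: open_comp; [move=> x _; exact: cf|exact: interval_open].
Qed.

Lemma continuous_borel_rV_measurable (f : 'rV[R]_n -> 'rV[R]_n) : continuous f ->
  measurable_fun [set: borel_rV R n] (f : borel_rV R n -> borel_rV R n).
Proof.
move=> /continuousP cf.
apply: (@measurability _ _ (borel_rV R n) (borel_rV R n) _ f (@open 'rV[R]_n) erefl).
by move=> _ [U oU <-]; rewrite setTI; apply: open_borel_measurable; exact: cf.
Qed.

Lemma continuous_enorm : continuous (@enorm R n).
Proof.
move=> x; apply: (@continuous_comp _ _ _ (fun x : 'rV[R]_n => dot x x)).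
  by apply: continuous_dot => y; exact: cvg_id.
exact: sqrt_continuous.
Qed.

Lemma measurable_sphere : measurable (sphere R n : set (borel_rV R n)).
Proof.
rewrite (_ : sphere R n = (fun u : borel_rV R n => enorm u) @^-1` [set 1]).
  rewrite -[X in measurable X]setTI.
  exact: (continuous_borel_measurable continuous_enorm).
by [].
Qed.

Lemma open_setC_sphere : open (~` sphere R n).
Proof.
rewrite (_ : ~` _ = @enorm R n @^-1` [set r | r != 1]).
  by apply: open_comp => [x _|]; [exact: continuous_enorm|exact: open_neq].
by apply/seteqP; split => x /= /eqP.
Qed.

Lemma measure_support_sub_sphere (Xi : probability (borel_rV R n) R) :
  Xi (sphere R n) = 1%E -> measure_support Xi `<=` sphere R n.
Proof.
move=> Xi1 u supp_u; apply: contrapT => nu.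
have := supp_u _ open_setC_sphere nu.
rewrite probability_setC; last exact: measurable_sphere.
by rewrite Xi1 subee// ltxx.
Qed.

(* Cubes with rational centre and rational half-width form a countable basis. *)
Lemma setC_measure_support_negligible (Xi : probability (borel_rV R n) R) :
  Xi.-negligible (~` measure_support Xi).
Proof.
pose cube (c : 'rV[rat]_n * rat) : set 'rV[R]_n :=
  ball (map_mx ratr c.1 : 'rV[R]_n) (ratr c.2 : R).
have ocube c : open (cube c) by exact: ball_open.
(* The [k]-th rational cube is kept when it is null and replaced by the empty set otherwise. *)
pose N k : set (borel_rV R n) :=
  if unpickle k is Some c then if Xi (cube c) == 0%E then cube c else set0
  else set0.
have : Xi.-negligible (\bigcup_k N k).
  apply: negligible_bigcup => k; rewrite /N.
  case: unpickle => [c|]; last exact: negligible_set0.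
  case: eqP => c0; last exact: negligible_set0.
  by apply/negligibleP => //; exact: open_borel_measurable.
apply: negligibleS => u /existsNP[U /not_implyP[oU /not_implyP[Uu /negP]]].
rewrite -leNgt => XiU.
have /nbhs_ballP[e /= e0 eU] : nbhs u U by exact: open_nbhs_nbhs.
(* Half-width [r] below [e / 2] suffices: the centre is chosen within [r] of [u], so the cube
   contains [u] and stays within [e] of it. *)
have /rat_in_itvoo[r] : 0 < e / 2 by rewrite divr_gt0.
rewrite in_itv/= => /andP[r0 re].
have /choice[c cP] (i : 'I_n) : exists q : rat, `|ratr q - u 0 i| < ratr r.
  have /rat_in_itvoo[q] : u 0 i - ratr r < u 0 i + ratr r.
    by rewrite ltrD2l gtrN.
  by rewrite in_itv/= -ltr_distl; exists q.
pose C : 'rV[rat]_n * rat := (\row_i c i, r).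
have cubeU : cube C `<=` U.
  move=> y [_ Cy]; apply: eU; split => // i j; rewrite !ord1.
  have := Cy 0 j; rewrite !mxE /ball/= => yc.
  rewrite -(subrK (ratr (c j)) (u 0 j)) -addrA (le_lt_trans (ler_normD _ _))//.
  by rewrite [ltRHS]splitr ltrD//; [rewrite distrC (lt_trans (cP j))|exact: lt_trans re].
have C0 : Xi (cube C) = 0%E.
  apply/eqP; rewrite eq_le measure_ge0 andbT (le_trans _ XiU)// le_measure// inE.
    exact: open_borel_measurable.
  exact: open_borel_measurable.
exists (pickle C) => //; rewrite /N pickleK C0 eqxx.
by split => // i j; rewrite !ord1 !mxE; exact: cP.
Qed.

End Borel.

(** * Independence of the past *)

(** This is the Dynkin half of the pi-lambda argument: complements follow by subtraction from [P E],
    disjoint unions by countable additivity. *)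
Lemma independent_dynkin {R : realType} {disp : measure_display}
    {Omega : measurableType disp} (P : probability Omega R) (E : set Omega) :
  measurable E ->
  dynkin [set A | measurable A /\ P (A `&` E) = (P A * P E)%E].
Proof.
move=> mE; split=> /=.
- by rewrite setTI probability_setT mul1e.
- move=> A [mA AE]; split; first exact: measurableC.
  rewrite setIC -setDE.
  transitivity (P E - P (E `&` A))%E.
    by apply: measureD => //; rewrite (le_lt_trans (probability_le1 _ _)) ?ltry.
  rewrite setIC AE probability_setC// muleBl ?mul1e ?fin_num_measure//.
- move=> F tF FE; split; first by apply: bigcupT_measurable => k; case: (FE k).
  have mF k : measurable (F k) by case: (FE k).
  have PF : P (\bigcup_k F k) = (\sum_(k <oo) P (F k))%E.
    by rewrite measure_bigcup//; apply: eq_eseriesl => k; rewrite in_setT.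
  rewrite PF setI_bigcupl muleC -(fineK (fin_num_measure P E mE)) -nneseriesZl//.
  transitivity (\sum_(k <oo) P (F k `&` E))%E.
    rewrite measure_bigcup//.
    - by apply: eq_eseriesl => k; rewrite in_setT.
    - by move=> k _; exact: measurableI.
    - exact: trivIset_setIr.
  apply: eq_eseriesr => k _; rewrite fineK ?fin_num_measure// muleC.
  by case: (FE k).
Qed.

Section History.
Context {R : realType} {n : nat} {disp : measure_display}.
Context {Omega : measurableType disp} (P : probability Omega R).
Context (Xi : probability (borel_rV R n) R) (d : nat -> Omega -> borel_rV R n).
Hypothesis iid : iid_directions P Xi d.

Let md k (B : set (borel_rV R n)) : measurable B -> measurable (d k @^-1` B).
Proof. by move=> mB; rewrite -[X in measurable X]setTI; case: iid => md _ _; exact: md. Qed.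

Lemma history_measurable k A : history d k A -> measurable A.
Proof.
apply: smallest_sub; first exact: sigma_algebra_measurable.
by move=> _ [j _ [B mB <-]]; rewrite setTI; exact: md.
Qed.

(** The pi-lambda argument: cylinders over the first [k] directions are stable under intersection
    and generate the history, and on them the claim is the product rule. *)
Lemma history_independent k A (B : set (borel_rV R n)) :
  history d k A -> measurable B ->
  P (A `&` d k @^-1` B) = (P A * Xi B)%E.
Proof.
move=> hA mB; have [_ law indep] := iid; rewrite -(law k)//.
pose cyl (D : nat -> set (borel_rV R n)) :=
  \bigcap_(i in [set` iota 0 k]) d i @^-1` D i.
pose G := [set cyl D | D in [set D | forall i, measurable (D i)]].
suff: <<s G >> `<=` [set A | measurable A /\ P (A `&` d k @^-1` B) = (P A * P (d k @^-1` B))%E].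
  move=> /(_ A) [] //; move: A hA; apply: sub_smallest2r.
    exact: smallest_sigma_algebra.
  move=> _ [j jk [D mD <-]]; rewrite setTI.
  (* A generator of the history is the cylinder that constrains only the direction [j]. *)
  exists (fun i => if i == j then D else setT) => [i|]; first by case: ifP.
  apply/seteqP; split => w.
    by move=> /(_ j); rewrite /= mem_iota /= add0n => /(_ jk); rewrite eqxx.
  by move=> Dw i _ /=; case: eqP => // ->.
apply: lambda_system_subset => //.
- move=> _ _ [C mC <-] [D mD <-]; exists (fun i => C i `&` D i).
    by move=> i; exact: measurableI.
  apply/seteqP; split => w.
    by move=> CD; split => i ik; have [] := CD i ik.
  by move=> [Cw Dw] i ik; split; [exact: Cw|exact: Dw].
- by apply/dynkin_lambda_system/independent_dynkin/md.
- move=> _ [D mD <-]; split.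
    by apply: bigcap_measurableType => i _; exact: md.
  (* Adding [B] as constraint number [k] makes the intersection a cylinder over [k + 1] directions;
     the product rule is used for it and again for the first [k]. *)
  pose D' i := if i == k then B else D i.
  have mD' i : measurable (D' i) by rewrite /D'; case: ifP.
  have D'D i : i \in iota 0 k -> D' i = D i.
    by rewrite mem_iota /D' => /andP[_]; rewrite add0n; case: ltngtP.
  have D'k : D' k = B by rewrite /D' eqxx.
  have := indep (iota 0 k.+1) D' (iota_uniq _ _) mD'.
  rewrite -addn1 iotaD add0n/= big_cat big_seq1/= D'k.
  rewrite (_ : \prod_(i <- iota 0 k) P (d i @^-1` D' i) = P (cyl D))%E; last first.
    rewrite indep ?iota_uniq//; apply: eq_big_seq => i ik; rewrite D'D//.
  move=> <-; congr (P _); apply/seteqP; split => w.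
    move=> [Dw Bw] i; rewrite /= mem_cat => /orP[ik|].
      by rewrite D'D//; exact: Dw.
    by rewrite inE => /eqP ->; rewrite D'k.
  move=> D'w; split.
    move=> i /= ik; have := D'w i; rewrite /= mem_cat ik D'D//; exact.
  by have := D'w k; rewrite /= mem_cat inE eqxx orbT D'k; exact.
Qed.

End History.

Section Fubini.
Context {R : realType} {n : nat} {disp : measure_display}.
Context {Omega : measurableType disp} (P : probability Omega R).
Context (Xi : probability (borel_rV R n) R) (d : nat -> Omega -> borel_rV R n).
Hypothesis iid : iid_directions P Xi d.

(** Independence makes the joint law of [X] and [d k] the product of the law of [X] with [Xi];
    Tonelli's theorem then applies. *)
Lemma history_fubini k (X : Omega -> borel_rV R n)
    (F : borel_rV R n * borel_rV R n -> \bar R) :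
  (forall B : set (borel_rV R n), measurable B -> history d k (X @^-1` B)) ->
  measurable_fun setT F -> (forall z, 0 <= F z)%E ->
  (\int[P]_w F (X w, d k w) = \int[P]_w \int[Xi]_u F (X w, u))%E.
Proof.
move=> hX mF F0.
have mX : measurable_fun setT X.
  by move=> _ B mB; rewrite setTI; exact: (history_measurable iid (hX B mB)).
have mdk : measurable_fun setT (d k) by case: iid.
have mZ : measurable_fun setT (fun w => (X w, d k w)) by exact: measurable_fun_pair.
pose X' : {mfun Omega >-> borel_rV R n} := mfun_Sub (mem_set mX).
pose Z' : {mfun Omega >-> (borel_rV R n * borel_rV R n)%type} := mfun_Sub (mem_set mZ).
transitivity (\int[distribution P Z']_z F z)%E.
  by rewrite ge0_integral_pushforward.
transitivity (\int[distribution P X' \x Xi]_z F z)%E.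
  apply: eq_measure_integral => A mA _; symmetry; apply: product_measure_unique => //.
  by move=> C D mC mD; exact: (history_independent iid (hX C mC) mD).
rewrite fubini_tonelli1// ge0_integral_pushforward//.
- exact: measurable_fun_fubini_tonelli_F.
- by move=> x _; exact: integral_ge0.
Qed.

End Fubini.

(** * Randomised steps *)

Lemma measurable_dot_sqr {R : realType} {n : nat} {disp : measure_display}
    {T : measurableType disp} (f g : T -> borel_rV R n) :
  measurable_fun setT f -> measurable_fun setT g ->
  measurable_fun setT (fun t => dot (f t) (g t) ^+ 2).
Proof.
move=> mf mg; apply: measurable_funX; apply: measurable_sum => i.
have mc : measurable_fun setT (fun x : borel_rV R n => (x : 'rV[R]_n) 0 i).
  by apply: continuous_borel_measurable; exact: coord_continuous.
have mcoord (h : T -> borel_rV R n) : measurable_fun setT h ->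
    measurable_fun setT (fun t : T => (h t : 'rV[R]_n) 0 i).
  by move=> mh; exact: (measurableT_comp mc mh).
by apply: measurable_funM; exact: mcoord.
Qed.

Lemma sphere_second_moment {R : realType} {n : nat}
    (Xi : probability (borel_rV R n) R) (zeta : R) (g : 'rV[R]_n) :
  is_minimum (sphere R n)
    (fun e => 'E_Xi[(fun u : borel_rV R n => (dot u e ^+ 2)%R)]%E) zeta%:E ->
  ((zeta * enorm g ^+ 2)%:E <= \int[Xi]_u (dot g u ^+ 2)%:E)%E.
Proof.
move=> [_ zeta_min]; have [g0|g0] := eqVneq (enorm g) 0.
  rewrite g0 expr0n mulr0; apply: integral_ge0 => u _.
  by rewrite lee_fin sqr_ge0.
(* Both sides are quadratic in [g], so the minimality of [zeta] is used at the unit vector along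
   [g]. *)
pose e := (enorm g)^-1 *: g.
have /zeta_min : sphere R n e.
  by rewrite /sphere /= enormZ ger0_norm ?invr_ge0 ?enorm_ge0// mulVf.
rewrite unlock => ze.
have -> : (\int[Xi]_u (dot g u ^+ 2)%:E =
    \int[Xi]_u ((enorm g ^+ 2)%:E * (dot u e ^+ 2)%:E))%E.
  apply: eq_integral => u _; rewrite -EFinM; congr EFin.
  by rewrite /e dotZr (dotC g) exprMn mulrA -exprMn mulfV// expr1n mul1r.
rewrite ge0_integralZl_EFin ?sqr_ge0//.
- by rewrite EFinM muleC lee_wpmul2l// lee_fin sqr_ge0.
- by move=> u _; rewrite lee_fin sqr_ge0.
- apply/measurable_EFinP; apply: measurable_dot_sqr => //.
Qed.

Section RandomisedStep.
Context {R : realType} {n : nat} (V : 'rV[R]_n -> R).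
Implicit Types x u : 'rV[R]_n.

(** The implicit equation says that the value drops by exactly [t * a ^+ 2]. *)
Lemma randomised_itoh_abe_step_decrease (t : R) u x x' : 0 < t ->
  randomised_itoh_abe_step V t u x x' -> V x' <= V x.
Proof.
move=> t0 [[a [a0 + ->]]|[_ ->]//]; rewrite -subr_le0.
set h := t * a => aE.
have h0 : h != 0 by rewrite mulf_neq0// gt_eqF.
have -> : V (x - h *: u) - V x = - (a * h) by rewrite {1}aE mulNr divfK// opprK.
by rewrite oppr_le0 /h mulrCA -expr2 mulr_ge0 ?sqr_ge0// ltW.
Qed.

(** With [h = t * a] and [G = dot (grad V x) u], the first-order remainder gives
    [|h * G - a * h| <= K * h ^+ 2 / 2]. Dividing by [|h|] yields [|G| <= |a| * (1 + K * t / 2)],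
    and squaring gives the claim, the decrease being [a * h]. *)
Lemma randomised_itoh_abe_step_dot_sqr_le (L t K : R) u x x' :
  smooth L V -> 0 < t -> 0 <= K ->
  (forall y a,
    `|dot (grad V (y + a *: u)) u - dot (grad V y) u| <= K * `|a|) ->
  randomised_itoh_abe_step V t u x x' ->
  dot (grad V x) u ^+ 2 <= t * (t^-1 + K / 2) ^+ 2 * (V x - V x').
Proof.
move=> V_smooth t0 K0 lipu [[a [a0 + ->]]|[-> ->]]; last by rewrite expr0n subrr mulr0.
move hE : (t * a) => h aE.
have h0 : h != 0 by rewrite -hE mulf_neq0// gt_eqF.
have dE : V (x - h *: u) - V x = - (a * h) by rewrite {1}aE mulNr divfK// opprK.
have := @first_order_remainder _ _ V L V_smooth x (- (h *: u)) (K * h ^+ 2).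
(* One factor [|h|] comes from the displacement, the other from the direction paired with the
   gradient. *)
have H s : 0 <= s <= 1 ->
    `|dot (grad V (x + s *: - (h *: u))) (- (h *: u)) -
      dot (grad V x) (- (h *: u))| <= K * h ^+ 2 * s.
  move=> /andP[s0 _]; rewrite -!scaleNr scalerA !dotZr -mulrBr normrM.
  rewrite normrN; apply: le_trans (ler_wpM2l (normr_ge0 _) (lipu _ _)) _.
  rewrite mulrN normrN normrM (ger0_norm s0) -(real_normK (num_real h)).
  by rewrite le_eqVlt; apply/orP; left; apply/eqP; ring.
move=> /(_ H); rewrite dE dotNr dotZr.
set G := dot (grad V x) u => remainder.
rewrite -opprB dE opprK.
have -> : t * (t^-1 + K / 2) ^+ 2 * (a * h) = (`|a| * (1 + K * t / 2)) ^+ 2.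
  by rewrite exprMn real_normK ?num_real// -hE; field; rewrite gt_eqF.
apply: sqr_le_of_normr_le.
have nh : 0 < `|h| by rewrite normr_gt0.
rewrite -(ler_pM2l nh) -normrM.
have -> : `|h| * (`|a| * (1 + K * t / 2)) = a * h + K * h ^+ 2 / 2.
  rewrite -hE normrM (gtr0_norm t0).
  transitivity (`|a| ^+ 2 * (t * (1 + K * t / 2))); first by ring.
  by rewrite real_normK ?num_real//; field.
have -> : h * G = a * h + (- (a * h) - - (h * G)) by ring.
apply: le_trans (ler_normD _ _) _; apply: lerD remainder.
by rewrite ger0_norm// -hE mulrCA -expr2 mulr_ge0 ?sqr_ge0// ltW.
Qed.

End RandomisedStep.

Lemma bounded_integrable {R : realType} {disp : measure_display}
    {Omega : measurableType disp} (P : probability Omega R) (f : Omega -> R) (M : R) :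
  measurable_fun setT f -> (forall w, `|f w| <= M) ->
  P.-integrable setT (EFin \o f).
Proof.
move=> mf fM; have := finite_measure_integrable_cst P M measurableT.
apply: le_integrable => //.
  exact/measurable_EFinP.
by move=> w _; rewrite lee_fin (le_trans (fM w))// ler_norm.
Qed.

Lemma EFin_Rintegral {R : realType} {disp : measure_display}
    {Omega : measurableType disp} (P : probability Omega R) (f : Omega -> R) :
  P.-integrable setT (EFin \o f) ->
  (\int[P]_w (f w)%:E = (\int[P]_w f w)%R%:E)%E.
Proof. by move=> intf; rewrite fineK//; exact: integrable_fin_num. Qed.

(** * Expected decay of the randomised Itoh-Abe method *)

Section RandomisedRate.
Context {R : realType} {n : nat} (V : 'rV[R]_n -> R).
Variables (L mu Vstar taumin taumax : R) (tau : nat -> R).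
Hypotheses (V_smooth : smooth L V) (Vstar_min : is_minimum setT V Vstar).
Hypotheses (mu_gt0 : 0 < mu) (V_PL : polyak_lojasiewicz mu Vstar V).
Hypotheses (taumin_gt0 : 0 < taumin).
Hypothesis tau_bounds : forall k, taumin <= tau k <= taumax.
Context {disp : measure_display} {Omega : measurableType disp}.
Variables (Xi : probability (borel_rV R n) R) (zeta : R) (Ld : 'rV[R]_n -> R).
Variables (P : probability Omega R) (d : nat -> Omega -> borel_rV R n).
Variables (x0 : 'rV[R]_n) (x : nat -> Omega -> 'rV[R]_n).
Hypothesis Xi_sphere : Xi (sphere R n) = 1%E.
Hypothesis zeta_min : is_minimum (sphere R n)
  (fun e => 'E_Xi[(fun u : borel_rV R n => (dot u e ^+ 2)%R)]%E) zeta%:E.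
Hypothesis zeta_gt0 : 0 < zeta.
Hypothesis Ld_le : forall u, sphere R n u -> Ld u <= L.
Hypothesis Ld_lip : forall u, sphere R n u -> forall y a,
  `|dot (grad V (y + a *: u)) u - dot (grad V y) u| <= Ld u * `|a|.
Hypothesis iid : iid_directions P Xi d.
Hypothesis iter : randomised_itoh_abe_iterates V tau d x0 x.

Let Lmax := sup (Ld @` measure_support Xi).

Let tau_gt0 k : 0 < tau k.
Proof. by case/andP: (tau_bounds k) => + _; exact: lt_le_trans. Qed.

Let supp_sphere : measure_support Xi `<=` sphere R n.
Proof. exact: measure_support_sub_sphere. Qed.

Lemma Ld_ge0 u : sphere R n u -> 0 <= Ld u.
Proof.
by move=> /Ld_lip/(_ 0 1); rewrite normr1 mulr1; exact: le_trans (normr_ge0 _).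
Qed.

Lemma Ld_le_Lmax u : measure_support Xi u -> Ld u <= Lmax.
Proof.
move=> su; apply: ub_le_sup; last by exists u.
by exists L => _ [v sv <-]; exact/Ld_le/supp_sphere.
Qed.

Lemma Lmax_ge0 : 0 <= Lmax.
Proof.
(* On an empty support [sup] takes its default value 0. *)
have [S0|/set0P[u su]] := eqVneq (measure_support Xi) set0.
  by rewrite /Lmax S0 image_set0 sup0.
by apply: le_trans (Ld_le_Lmax su); exact/Ld_ge0/supp_sphere.
Qed.

Lemma V_iterate_decrease k w : V (x k.+1 w) <= V (x k w).
Proof.
case: iter => _ _ /(_ k w); exact: randomised_itoh_abe_step_decrease.
Qed.

(** These bounds are uniform in [w], which makes every [V (x k w)] integrable. *)
Lemma V_iterate_bounds k w : Vstar <= V (x k w) <= V x0.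
Proof.
rewrite (proj2 Vstar_min)//=; elim: k => [|k IH]; first by case: iter => ->.
exact: le_trans (V_iterate_decrease k w) IH.
Qed.

Let mx k : measurable_fun setT (x k : Omega -> borel_rV R n).
Proof.
move=> _ B mB; rewrite setTI; apply: (history_measurable iid (k := k)).
by case: iter => _ hx _; exact: hx.
Qed.

Let mVx k : measurable_fun setT (fun w => V (x k w)).
Proof.
have mV : measurable_fun setT (V : borel_rV R n -> R).
  apply: continuous_borel_measurable => y; apply: differentiable_continuous.
  by case: V_smooth.
exact: (measurableT_comp mV (mx k)).
Qed.

Let intVx k : P.-integrable setT (EFin \o (fun w => V (x k w))).
Proof.
apply: (@bounded_integrable _ _ _ _ _ (`|Vstar| + `|V x0|)) => // w.
have /andP[l u] := V_iterate_bounds k w.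
have := ler_norm (- Vstar); rewrite normrN.
have := ler_norm (V x0); have := normr_ge0 Vstar; have := normr_ge0 (V x0).
by rewrite ler_norml; lra.
Qed.

Let gap k : R := \int[P]_w (V (x k w) - Vstar).

Let mgradV : measurable_fun setT (grad V : borel_rV R n -> borel_rV R n).
Proof. by apply: continuous_borel_rV_measurable; case: V_smooth. Qed.

Let mF : measurable_fun setT
  (fun z : borel_rV R n * borel_rV R n => (dot (grad V z.1) z.2 ^+ 2)%:E).
Proof.
apply/measurable_EFinP; apply: measurable_dot_sqr; last exact: measurable_snd.
exact: (measurableT_comp mgradV measurable_fst).
Qed.

(** Averaging over the fresh direction first leaves at least [zeta] times the squared gradient norm,
    to which the Polyak-Łojasiewicz inequality applies. *)
Lemma second_moment_le k :
  (\int[P]_w (zeta * (2 * mu * (V (x k w) - Vstar)))%:E <=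
   \int[P]_w (dot (grad V (x k w)) (d k w) ^+ 2)%:E)%E.
Proof.
have hx : forall B : set (borel_rV R n), measurable B -> history d k (x k @^-1` B).
  by case: iter => _ hx _; exact: hx.
have F0 (z : borel_rV R n * borel_rV R n) :
    (0 <= (dot (grad V z.1) z.2 ^+ 2)%:E)%E by rewrite lee_fin sqr_ge0.
rewrite (history_fubini iid hx mF F0).
apply: ge0_le_integral => //.
- move=> w _; rewrite lee_fin; apply: mulr_ge0; first exact: ltW.
  apply: mulr_ge0; first by rewrite mulr_ge0// ltW.
  by rewrite subr_ge0; case/andP: (V_iterate_bounds k w).
- apply/measurable_EFinP; do 2 apply: measurable_funM => //.
  exact: measurable_funB.
- have mG := measurable_fun_fubini_tonelli_F (m2 := Xi) _ mF F0.
  have := measurableT_comp mG (mx k); exact.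
move=> w _; apply: le_trans (sphere_second_moment (grad V (x k w)) zeta_min).
rewrite lee_fin ler_pM2l//; have := V_PL (x k w); lra.
Qed.

(** The one-step bound with [Lmax] is available when the direction lies in the support of [Xi],
    hence almost surely, since [d k] has law [Xi]. *)
Lemma second_moment_ge k :
  (\int[P]_w (dot (grad V (x k w)) (d k w) ^+ 2)%:E <=
   \int[P]_w (tau k * ((tau k)^-1 + Lmax / 2) ^+ 2 *
      (V (x k w) - V (x k.+1 w)))%:E)%E.
Proof.
apply: ae_ge0_le_integral => //.
- by move=> w _; rewrite lee_fin sqr_ge0.
- apply/measurable_EFinP; apply: measurable_dot_sqr; last by case: iid.
  exact: (measurableT_comp mgradV (mx k)).
- move=> w _; rewrite lee_fin mulr_ge0//.
    by rewrite mulr_ge0 ?sqr_ge0// ltW.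
  by rewrite subr_ge0 V_iterate_decrease.
- apply/measurable_EFinP; apply: measurable_funM => //.
  exact: measurable_funB.
have [N [mN N0 suppN]] := setC_measure_support_negligible Xi.
have [md law _] := iid.
exists (d k @^-1` N); split.
- by rewrite -[X in measurable X]setTI; exact: md.
- exact: (etrans (law k N mN) N0).
move=> w; apply: contra_notP => dN _.
have sd : measure_support Xi (d k w) by apply: contrapT => /suppN.
rewrite lee_fin.
apply: (randomised_itoh_abe_step_dot_sqr_le V_smooth (tau_gt0 k) Lmax_ge0).
  move=> y a; apply: le_trans (Ld_lip (supp_sphere sd) y a) _.
  by rewrite ler_wpM2r// Ld_le_Lmax.
by case: iter.
Qed.

Lemma randomised_rate k :
  ('E_P[(fun w => V (x k w))] - Vstar%:E <=
    ((1 - 2 * mu / sup_beta (beta_randomised zeta Lmax) tau) ^+ k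
      * (V x0 - Vstar))%:E)%E.
Proof.
have icst (c : R) : P.-integrable setT (EFin \o cst c).
  exact: finite_measure_integrable_cst.
have cstE (c : R) : \int[P]_w c = c.
  transitivity (c * fine (P setT)); first exact: Rintegral_cst.
  by rewrite probability_setT mulr1.
have gapE j : gap j = \int[P]_w V (x j w) - Vstar.
  rewrite /gap RintegralB//; last exact: icst.
  by congr (_ - _); exact: cstE.
have gap0 : gap 0%N = V x0 - Vstar.
  rewrite /gap (@eq_Rintegral _ _ _ _ _ (cst (V x0 - Vstar))); last first.
    by move=> w _; case: iter => ->.
  exact: cstE.
have -> : ('E_P[(fun w => V (x k w))] = (\int[P]_w V (x k w))%R%:E)%E.
  by rewrite unlock; exact: EFin_Rintegral.
rewrite -EFinB lee_fin -gapE -gap0.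
apply: geometric_decay => j.
  apply: Rintegral_ge0 => w _; rewrite subr_ge0.
  by case/andP: (V_iterate_bounds j w).
have beta_gt0 : 0 < beta_randomised zeta Lmax (tau j).
  rewrite /beta_randomised mulr_gt0 ?divr_gt0// exprn_gt0// ltr_wpDr ?invr_gt0//.
  by rewrite divr_ge0// Lmax_ge0.
apply: (PL_contraction mu_gt0 beta_gt0).
(* The prefactor is largest at [taumax] and the squared factor at [taumin]; bounding them separately
   suffices. *)
- apply: (@sup_beta_ge _ _ _ (taumax / zeta * (taumin^-1 + Lmax / 2) ^+ 2)) => i.
  have /andP[ti it] := tau_bounds i.
  have Lm := Lmax_ge0.
  rewrite /beta_randomised ler_pM ?divr_ge0 ?sqr_ge0 ?(ltW zeta_gt0) ?(ltW (tau_gt0 i))//.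
    by rewrite ler_wpM2r// invr_ge0 ltW.
  apply: sqr_le_of_normr_le; rewrite ger0_norm.
    by rewrite lerD2r lef_pV2 ?posrE.
  by rewrite addr_ge0 ?divr_ge0 ?invr_ge0// ltW.
- apply: Rintegral_ge0 => w _; rewrite subr_ge0.
  by case/andP: (V_iterate_bounds j w).
have intB f g : P.-integrable setT (EFin \o f) -> P.-integrable setT (EFin \o g) ->
    P.-integrable setT (EFin \o (fun w => f w - g w)).
  by move=> intf intg; exact: (integrableB measurableT intf intg).
have intZ c f : P.-integrable setT (EFin \o f) ->
    P.-integrable setT (EFin \o (fun w => c * f w)).
  by move=> intf; exact: (integrableZl measurableT c intf).
have intgap i : P.-integrable setT (EFin \o (fun w => V (x i w) - Vstar)).
  exact: (intB _ _ (intVx i) (icst Vstar)).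
have intdiff : P.-integrable setT (EFin \o (fun w => V (x j w) - V (x j.+1 w))).
  exact: (intB _ _ (intVx j) (intVx j.+1)).
(* Chaining the two estimates and dividing by [zeta] gives the hypothesis of [PL_contraction] for
   the expected gaps. *)
have := le_trans (second_moment_le j) (second_moment_ge j).
rewrite !EFin_Rintegral ?lee_fin; [|exact: (intZ _ _ intdiff)|exact: (intZ _ _ (intZ _ _ (intgap j)))].
rewrite !RintegralZl//; last exact: (intZ _ _ (intgap j)).
rewrite (_ : \int[P]_w (V (x j w) - V (x j.+1 w)) = gap j - gap j.+1); last first.
  by rewrite RintegralB// !gapE; ring.
rewrite -/(gap j) => H.
have -> : beta_randomised zeta Lmax (tau j) =
    zeta^-1 * (tau j * ((tau j)^-1 + Lmax / 2) ^+ 2).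
  by rewrite /beta_randomised mulrAC [RHS]mulrC.
by rewrite -[leRHS]mulrA ler_pdivlMl.
Qed.

End RandomisedRate.

Theorem theorem6p6 (R : realType) (n : nat) (V : 'rV[R]_n -> R)
    (L mu Vstar taumin taumax : R) (tau : nat -> R)
    (L_gt0 : 0 < L) (V_smooth : smooth L V)
    (Vstar_min : is_minimum setT V Vstar)
    (mu_gt0 : 0 < mu) (V_PL : polyak_lojasiewicz mu Vstar V)
    (taumin_gt0 : 0 < taumin) (taumin_le_taumax : taumin <= taumax)
    (tau_bounds : forall k, taumin <= tau k <= taumax) :
  [/\ (forall x : nat -> 'rV[R]_n,
        discrete_gradient_iterates gonzalez V tau x ->
        forall k, V (x k) - Vstar <=
          (1 - 2 * mu / sup_beta (beta_gonzalez L) tau) ^+ k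
          * (V (x 0%N) - Vstar)),
      (forall x : nat -> 'rV[R]_n,
        discrete_gradient_iterates mean_value V tau x ->
        forall k, V (x k) - Vstar <=
          (1 - 2 * mu / sup_beta (beta_mean_value L) tau) ^+ k
          * (V (x 0%N) - Vstar)),
      (forall (Lbar : 'I_n -> R) (x : nat -> 'rV[R]_n),
        (forall i, Lbar i <= L) ->
        (forall i y z,
          `|partial i V y - partial i V z| <= Lbar i * enorm (y - z)) ->
        discrete_gradient_iterates itoh_abe V tau x ->
        let Lsum := Num.sqrt (\sum_(i < n) Lbar i ^+ 2) in
        forall k, V (x k) - Vstar <=
          (1 - 2 * mu / sup_beta (beta_itoh_abe Lsum) tau) ^+ k
          * (V (x 0%N) - Vstar)) &
      (forall (Xi : probability (borel_rV R n) R) (zeta : R)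
          (Ld : 'rV[R]_n -> R)
          (disp : measure_display) (Omega : measurableType disp)
          (P : probability Omega R) (d : nat -> Omega -> borel_rV R n)
          (x0 : 'rV[R]_n) (x : nat -> Omega -> 'rV[R]_n),
        Xi (sphere R n) = 1%E ->
        is_minimum (sphere R n)
          (fun e => 'E_Xi[(fun u : borel_rV R n => (dot u e ^+ 2)%R)]%E) zeta%:E ->
        0 < zeta ->
        (forall u, sphere R n u -> Ld u <= L) ->
        (forall u, sphere R n u -> forall y a,
          `|dot (grad V (y + a *: u)) u - dot (grad V y) u| <= Ld u * `|a|) ->
        iid_directions P Xi d ->
        randomised_itoh_abe_iterates V tau d x0 x ->
        let Lmax := sup (Ld @` measure_support Xi) in
        forall k, ('E_P[(fun w => V (x k w))] - Vstar%:E <=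
          ((1 - 2 * mu / sup_beta (beta_randomised zeta Lmax) tau) ^+ k
          * (V x0 - Vstar))%:E)%E)].
Proof.
have rate := discrete_gradient_rate Vstar_min mu_gt0 V_PL taumin_gt0 tau_bounds.
split.
- move=> x; apply: (rate _ (L ^+ 2 / 2)).
  + by rewrite divr_ge0// sqr_ge0.
  + by move=> t; rewrite /beta_gonzalez mulrAC.
  + exact: (gonzalez_secant V).
  + exact: (gonzalez_dist V_smooth).
- move=> x; apply: (rate _ (L ^+ 2 / 4)).
  + by rewrite divr_ge0// sqr_ge0.
  + by move=> t; rewrite /beta_mean_value mulrAC.
  + exact: (mean_value_secant V_smooth).
  + exact: (mean_value_dist V_smooth).
- move=> Lbar x _ Lbar_lip iter Lsum.
  (* Nonnegativity ensures that squaring [Lsum] recovers the sum under the root. *)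
  have sum_ge0 : 0 <= \sum_(i < n) Lbar i ^+ 2.
    by apply: sumr_ge0 => i _; exact: sqr_ge0.
  apply: (rate _ (\sum_(i < n) Lbar i ^+ 2)) iter => //.
  + by move=> t; rewrite /beta_itoh_abe sqr_sqrtr.
  + exact: (itoh_abe_secant V).
  + by move=> y z; exact: (itoh_abe_dist V_smooth).
- move=> Xi zeta Ld disp Omega P d x0 x Xi_sphere zeta_min zeta_gt0 Ld_le Ld_lip.
  move=> iid iter Lmax.
  exact: (randomised_rate V_smooth Vstar_min mu_gt0 V_PL taumin_gt0 tau_bounds
    Xi_sphere zeta_min zeta_gt0 Ld_le Ld_lip iid iter).
Qed.
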